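(* Let $\mathbb{T}$ be a time scale, let $p:\mathbb{T}\to\mathbb{R}$, and let $\lambda>0$ be a real number. Assume $f,g:\mathbb{T}\rightarrow\mathbb{R}$ are continuous and structural differentiable (with respect to $\lambda$ and $p$) at $t\in \mathbb{T}^{\kappa}$. Then the following properties hold: (1) For any constant $\gamma$, the function $\gamma f:\mathbb{T}\rightarrow \mathbb{R}$ is structural differentiable at $t$ with $$(\gamma f)^{\Delta_{p}^{\lambda}}(t)=\gamma^{\lambda} f^{\Delta_{p}^{\lambda}}(t).$$ (2) The product $fg:\mathbb{T}\rightarrow \mathbb{R}$ is structural differentiable at $t$ with $$(fg)^{\Delta_{p}^{\lambda}}(t)=f^{\Delta_{p}^{\lambda}}(t)\, g^{\lambda}(t)+f^{\lambda}(\sigma(t))\, g^{\Delta_{p}^{\lambda}}(t)= f^{\Delta_{p}^{\lambda}}(t)\, g^{\lambda}(\sigma(t))+f^{\lambda}(t)\, g^{\Delta_{p}^{\lambda}}(t).$$ (3) If $f(t)f(\sigma(t))\neq 0$, then $\frac{1}{f}$ is structural differentiable at $t$ with $$\left(\frac{1}{f}\right)^{\Delta_{p}^{\lambda}}(t)=\frac{-f^{\Delta_{p}^{\lambda}}(t)}{f^{\lambda}(\sigma(t))f^{\lambda}(t)}.$$ (4) If $g(t)g(\sigma(t))\neq 0$, then $\frac{f}{g}$ is structural differentiable at $t$ with $$\left(\frac{f}{g}\right)^{\Delta_{p}^{\lambda}}(t)= \frac{f^{\Delta_{p}^{\lambda}}(t)\, g^{\lambda}(t)-f^{\lambda}(t)\,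 g^{\Delta_{p}^{\lambda}}(t)}{g^{\lambda}(\sigma(t))g^{\lambda}(t)}.$$
   Context: A time scale $\mathbb{T}$ is an arbitrary nonempty closed subset of $\mathbb{R}$. The forward jump operator $\sigma:\mathbb{T}\to\mathbb{T}$ is $\sigma(t)=\inf\{s\in\mathbb{T}:s>t\}$, and the backward jump operator $\rho:\mathbb{T}\to\mathbb{T}$ is $\rho(t)=\sup\{s\in\mathbb{T}:s<t\}$ (with the usual time-scale conventions $\inf\emptyset=\sup\mathbb{T}$ and $\sup\emptyset=\inf\mathbb{T}$). A point $t$ is left-scattered if $\rho(t)<t$. If $\mathbb{T}$ has a left-scattered maximum $m$, then $\mathbb{T}^{\kappa}=\mathbb{T}\setminus\{m\}$; otherwise $\mathbb{T}^{\kappa}=\mathbb{T}$. Notation: $f^{\lambda}(t)$ means $(f(t))^{\lambda}$. (In general, for instance when $\lambda=\frac12$ and the function takes negative values, these powers, and hence the derivative below, are complex numbers.) Structural derivative: let $f,p:\mathbb{T}\to\mathbb{R}$, $t\in\mathbb{T}^{\kappa}$ and $\lambda>0$. The structural derivative $f^{\Delta_{p}^{\lambda}}(t)$ of $f$ at $t$ (associated with $\lambda$ and $p$) is the number, provided it exists, with the property that given any $\epsilon>0$ there is a neighborhood $U$ of $t$ (i.e., $U=(t-\delta,t+\delta)\cap\mathbb{T}$ for some $\delta>0$) such that $$\left|[f^{\lambda}(\sigma(t))-f^{\lambda}(s)]-f^{\Delta_{p}^{\lambda}}(t)[p(\sigma(t))-p(s)]\right|\leq\epsilon\left|p(\sigma(t))-p(s)\right|$$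 for all $s\in U$. When this number exists, $f$ is called structural differentiable (or $\Delta_{p}^{\lambda}$-differentiable) at $t$.
   Formalization: False as stated for complex powers (λ=1/2, f=-1, g(s)=-s); near t and at σ(t), the formal version asks in (1),(2) that the factors not be both negative, in (3),(4) not numerator>0 with denominator<0, unless (2k+1)λ is an integer, where negatives have argument (2k+1)π. *)

(* Defs.v *)
From mathcomp Require Import all_boot all_order all_algebra.
From mathcomp Require Import all_classical all_reals all_analysis.
From mathcomp Require Import complex.

Set Implicit Arguments.
Unset Strict Implicit.
Unset Printing Implicit Defensive.

Import Order.TTheory GRing.Theory Num.Theory.
Import numFieldNormedType.Exports.

Local Open Scope classical_set_scope.
Local Open Scope ring_scope.
Local Open Scope complex_scope.

Definition time_scale (R : realType) (T : set R) : Prop :=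
  T !=set0 /\ closed T.

(* The library's [inf] and [sup] of the empty set are 0, hence the explicit
   conventions inf set0 = sup T and sup set0 = inf T. When the set
   {s in T | t < s} is empty and t is in T, t is the maximum of T and the value
   is t; symmetrically for [rho]. *)
Definition sigma (R : realType) (T : set R) (t : R) : R :=
  let A := [set s | T s /\ t < s] in
  if `[< A !=set0 >] then inf A else sup T.

Definition rho (R : realType) (T : set R) (t : R) : R :=
  let A := [set s | T s /\ s < t] in
  if `[< A !=set0 >] then sup A else inf T.

Definition left_scattered (R : realType) (T : set R) (t : R) : Prop :=
  rho T t < t.

Definition kappa (R : realType) (T : set R) : set R :=
  T `\` [set m | T m /\ ubound T m /\ left_scattered T m].

(* x ^ l for real x and real l > 0: the nonnegative real power when 0 <= x, and
   for x < 0 the complex number |x| ^ l * exp (i (2 k + 1) pi l), the power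
   computed with the argument (2 k + 1) pi of x. The principal power is k = 0;
   for l = m / n with n odd, k = (n - 1) / 2 gives the real n-th root. *)
Definition cpow (R : realType) (k : int) (l x : R) : R[i] :=
  if x < 0 then
    let a := (2 * k + 1)%:~R * pi * l in
    (`|x| `^ l)%:C * (cos a +i* sin a)
  else (x `^ l)%:C.

(* The pairs x, y for which (x y) ^ l = x ^ l y ^ l, resp. (with y <> 0)
   (x / y) ^ l = x ^ l / y ^ l. Writing c = (-1) ^ l, the first rule at
   x = y = -1 reads 1 = c ^ 2, and the second at x = 1, y = -1 reads c = 1 / c;
   both hold exactly when (2 k + 1) l is an integer. All other sign patterns are
   unproblematic. *)
Definition cpow_mul_rule (R : realType) (k : int) (l x y : R) : Prop :=
  (2 * k + 1)%:~R * l \is a Num.int \/ ~ (x < 0 /\ y < 0).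

Definition cpow_div_rule (R : realType) (k : int) (l x y : R) : Prop :=
  (2 * k + 1)%:~R * l \is a Num.int \/ ~ (0 < x /\ y < 0).

Definition near_and_at_sigma (R : realType) (T : set R) (t : R)
    (P : R -> Prop) : Prop :=
  P (sigma T t) /\ \forall s \near within T (nbhs t), P s.

(* "a is a structural derivative of f at t". This is a relation: a is unique as
   soon as p (sigma t) <> p s for points s of T arbitrarily close to t, but when
   p s = p (sigma t) for all s of T near t, either no number or every number
   qualifies. Functions on T are total functions on R, of which only the values
   on T are used. The norm of R[i] takes its values in R[i], hence the cast of
   the real right-hand side. *)
Definition is_sderive (R : realType) (T : set R) (k : int) (l : R)
    (p f : R -> R) (t : R) (a : R[i]) : Prop :=
  forall e : R, 0 < e -> exists2 d : R, 0 < d &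
    forall s : R, T s -> `|s - t| < d ->
      `| (cpow k l (f (sigma T t)) - cpow k l (f s))
         - a * (p (sigma T t) - p s)%:C |
      <= (e * `|p (sigma T t) - p s|)%:C.

(* Main.v *)
(* A number a is a structural derivative of f at t exactly when
   f^l(sigma t) - f^l(s) = Q(s) (p(sigma t) - p(s)) for s in T near t, with
   Q(s) -> a as s -> t in T (Caratheodory): take for Q the difference quotient
   where p(s) <> p(sigma t), and the constant a elsewhere, where the definition
   forces f^l(s) = f^l(sigma t). The product and quotient formulas are then limit
   algebra, given that x |-> x^l is continuous, which holds also at 0 as l > 0. *)
Require Import Defs.
From mathcomp Require Import all_boot all_order all_algebra.
From mathcomp Require Import all_classical all_reals all_analysis.
From mathcomp Require Import complex.
From mathcomp Require Import ring.
Import Order.TTheory GRing.Theory Num.Theory.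
Import numFieldNormedType.Exports.
Local Open Scope classical_set_scope.
Local Open Scope ring_scope.
Local Open Scope complex_scope.

(** * Algebra of complex powers of real numbers *)

Lemma sin_int_pi {R : realType} (n : int) : sin (n%:~R * pi) = 0 :> R.
Proof.
have sin_nat m : sin (m%:R * pi) = 0 :> R.
  elim: m => [|m IHm]; first by rewrite mul0r sin0.
  by rewrite -natr1 mulrDl mul1r sinDpi IHm oppr0.
by case: n => m; rewrite ?NegzE ?mulrNz ?mulNr ?sinN -pmulrn sin_nat ?oppr0.
Qed.

(** This is the chosen value of (-1)^l, the unit factor that a negative base contributes. *)
Definition cphase {R : realType} (k : int) (l : R) : R[i] :=
  let a := (2 * k + 1)%:~R * pi * l in cos a +i* sin a.

Lemma cpowE {R : realType} (k : int) (l x : R) :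
  cpow k l x = (`|x| `^ l)%:C * (if x < 0 then cphase k l else 1).
Proof.
rewrite /cpow; case: ltP => // x0.
by rewrite mulr1 ger0_norm.
Qed.

Lemma norm_cphase {R : realType} (k : int) (l : R) : `|cphase k l| = 1.
Proof. by rewrite normc_def /= cos2Dsin2 sqrtr1. Qed.

(** The argument is then an integer multiple of pi, so the sine vanishes and the phase is a real
    number of modulus one. *)
Lemma cphase_sqr {R : realType} (k : int) (l : R) :
  (2 * k + 1)%:~R * l \is a Num.int -> cphase k l * cphase k l = 1.
Proof.
rewrite /cphase => /intrP[n kl]; rewrite mulrAC kl.
have := cos2Dsin2 (n%:~R * pi : R); rewrite sin_int_pi expr0n addr0 => c2.
by apply/eqP; rewrite eq_complex /= !mulr0 !mul0r subr0 addr0 -expr2 c2 !eqxx.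
Qed.

Lemma cpow0 {R : realType} (k : int) (l : R) : 0 < l -> cpow k l 0 = 0.
Proof. by move=> l0; rewrite cpowE normr0 powR0 ?gt_eqF// mul0r. Qed.

Lemma cpow1 {R : realType} (k : int) (l : R) : cpow k l 1 = 1.
Proof. by rewrite /cpow ltr10 powR1. Qed.

Lemma cpow_eq0 {R : realType} (k : int) (l x : R) :
  0 < l -> (cpow k l x == 0) = (x == 0).
Proof.
move=> l0; rewrite cpowE mulf_eq0 fmorph_eq0 powR_eq0 normr_eq0 (gt_eqF l0) andbT.
case: ifP => _; last by rewrite oner_eq0 orbF.
by rewrite -[cphase k l == 0]normr_eq0 norm_cphase oner_eq0 orbF.
Qed.

(** Moduli always multiply, so only phases matter. They can disagree only when both factors are
    negative, where the rule demands that the squared phase be 1. *)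
Lemma cpowM {R : realType} (k : int) (l x y : R) : 0 < l ->
  cpow_mul_rule k l x y -> cpow k l (x * y) = cpow k l x * cpow k l y.
Proof.
move=> l0 xy.
have [->|x0] := eqVneq x 0; first by rewrite mul0r cpow0// mul0r.
have [->|y0] := eqVneq y 0; first by rewrite mulr0 cpow0// mulr0.
rewrite !cpowE normrM powRM// rmorphM /= mulrACA; congr (_ * _).
case: (ltgtP x 0) x0 => // x0 _; case: (ltgtP y 0) y0 => // y0 _.
- rewrite ltNge nmulr_rge0// (ltW y0) /=.
  by case: xy => [/cphase_sqr ->//|[]].
- by rewrite nmulr_rlt0// y0 mulr1.
- by rewrite pmulr_rlt0// y0 mul1r.
- by rewrite pmulr_rlt0// ltNge (ltW y0) mulr1.
Qed.

(** Apply the product rule to [x / y] and [y]: these are both negative only if [0 < x] and [y < 0].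
    For [y = 0] both sides vanish since [0^-1 = 0]. *)
Lemma cpow_div {R : realType} (k : int) (l x y : R) : 0 < l ->
  cpow_div_rule k l x y -> cpow k l (x / y) = cpow k l x / cpow k l y.
Proof.
move=> l0 xy.
have [->|y0] := eqVneq y 0; first by rewrite invr0 mulr0 cpow0// invr0 mulr0.
have {2}-> : x = x / y * y by rewrite mulfVK.
rewrite (cpowM _ _ (x / y)) ?mulfK ?cpow_eq0//.
case: xy => [kl|xy]; [by left | right => -[xy0 yn]; apply: xy; split=> //].
by move: xy0; rewrite nmulr_llt0 ?invr_lt0.
Qed.

(** * Limits and continuity of the complex power *)

Lemma cvgMr_near {C : numFieldType} {I : Type} {W : set_system I}
    {FW : Filter W} (u F : I -> C) (c a : C) :
  u @ W --> a -> (\forall s \near W, u s * c = F s) -> F @ W --> a * c.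
Proof.
move=> ua Fu.
have cvg_uc : u s * c @[s --> W] --> a * c by apply: cvgM => //; exact: cvg_cst.
by apply: cvg_trans cvg_uc; exact: near_eq_cvg.
Qed.

Lemma cvg0_norm_near {C : numFieldType} {I : Type} {W : set_system I}
    {FW : Filter W} (u F : I -> C) :
  u @ W --> 0 -> (\forall s \near W, `|F s| = `|u s|) -> F @ W --> 0.
Proof.
move=> /cvgrPdist_le u0 Fu; apply/cvgrPdist_le => e e0; near=> s.
by rewrite sub0r normrN (near Fu)// -normrN -sub0r; near: s; exact: u0.
Unshelve. all: by end_near. Qed.

(** Eliminating [x'] and [y'] turns both sides into [a * y + x * b + a * b * d]. *)
Lemma product_rule_sym {C : comNzRingType} {a b d x x' y y' : C} :
  x' - x = a * d -> y' - y = b * d -> a * y + x' * b = a * y' + x * b.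
Proof. by move=> /(canRL (subrK _)) -> /(canRL (subrK _)) ->; ring. Qed.

(* R[i] carries no topology of its own; seen as an abstract numFieldType it has
   the one defined by its norm. *)
Definition complexField (R : realType) : numFieldType := R[i].

Lemma norm_real_complex {R : realType} (x : R) : `|x%:C| = `|x|%:C.
Proof. by rewrite normc_def /= expr0n addr0 sqrtr_sqr. Qed.

Lemma cvg_real_complex {R : realType} {I : Type} {W : set_system I}
    {FW : Filter W} (u : I -> R) (x : R) : u @ W --> x ->
  (fun s => (u s)%:C : complexField R) @ W --> (x%:C : complexField R).
Proof.
move=> /cvgrPdist_le ux; apply/cvgrPdist_le => e.
(* In the order of [R[i]], a positive number is real, so complex tolerances reduce to real ones. *)
rewrite ltcE /= => /andP[/eqP Ime e0].
near=> s.
have -> : e = (complex.Re e)%:C by apply/eqP; rewrite eq_complex /= Ime !eqxx.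
rewrite -rmorphB norm_real_complex lecR.
by near: s; exact: ux.
Unshelve. all: by end_near. Qed.

Lemma continuous_norm_powR {R : realType} (l : R) :
  0 < l -> continuous (fun x : R => `|x| `^ l).
Proof.
move=> l0 x; have [->|x0] := eqVneq x 0.
  apply/cvgrPdist_le => e e0; have d0 : 0 < e `^ l^-1 by rewrite powR_gt0.
  near=> y; rewrite normr0 powR0 ?gt_eqF// sub0r normrN ger0_norm ?powR_ge0//.
  have -> : e = (e `^ l^-1) `^ l by rewrite -powRrM mulVf ?gt_eqF// powRr1 ?ltW.
  apply: ge0_ler_powR; [exact: ltW | exact: normr_ge0 | exact: powR_ge0 | ].
  by apply: ltW; near: y; exact: (@nbhs0_lt R R _ d0).
have powR_cont : {for `|x|, continuous (fun y : R => y `^ l)}.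
  apply: differentiable_continuous; apply/derivable1_diffP.
  by apply: derivable_powR; rewrite in_itv /= normr_gt0 x0.
exact: (cvg_comp (fun y : R => `|y|) _ (@norm_continuous R R x) powR_cont).
Unshelve. all: by end_near. Qed.

(** Away from 0 the phase is locally constant. At 0 it may jump, but it has modulus one and the
    other factor tends to 0. *)
Lemma cpow_continuous {R : realType} (k : int) (l x : R) : 0 < l ->
  (cpow k l y : complexField R) @[y --> x] --> (cpow k l x : complexField R).
Proof.
move=> l0.
have norm_cvg := cvg_real_complex (FW := nbhs_filter x) _ _
  (continuous_norm_powR l l0 x).
have phase_cvg (c : complexField R) :
    (\forall y \near x, (if y < 0 then cphase k l else 1) = c) ->
    (cpow k l y : complexField R) @[y --> x]
      --> ((`|x| `^ l)%:C : complexField R) * c.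
  move=> yc; apply: (cvgMr_near _ _ _ _ norm_cvg); near=> y.
  by rewrite cpowE (near yc).
case: (ltgtP x 0) => x0.
- rewrite [cpow k l x]cpowE x0; apply: phase_cvg.
  by near=> y; rewrite ifT//; near: y; exact: lt_nbhsl.
- rewrite [cpow k l x]cpowE ltNge (ltW x0); apply: phase_cvg.
  near=> y; rewrite ifF//; apply/negbTE; rewrite -leNgt ltW//.
  by near: y; exact: lt_nbhsr.
- have norm0 : (`|x| `^ l)%:C = 0 :> complexField R.
    by rewrite x0 normr0 powR0// gt_eqF.
  have cpowx0 : cpow k l x = 0 :> complexField R by rewrite x0 cpow0.
  rewrite norm0 in norm_cvg; rewrite cpowx0.
  apply: (cvg0_norm_near _ _ norm_cvg); near=> y.
  rewrite cpowE normrM.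
  by case: ifP => _; rewrite ?norm_cphase ?normr1 mulr1.
Unshelve. all: by end_near. Qed.

(** * Calculus of Caratheodory slopes along a filter *)

Definition slope_cvg {C : numFieldType} {I : Type} (W : set_system I)
    (Fs : C) (F D : I -> C) (a : C) : Prop :=
  exists2 Q : I -> C, Q @ W --> a & \forall s \near W, Fs - F s = Q s * D s.

Lemma slope_cvgP {C : numFieldType} {I : Type} {W : set_system I}
    {FW : Filter W} (Fs : C) (F D : I -> C) (a : C) :
  slope_cvg W Fs F D a <->
  forall e : C, 0 < e ->
    \forall s \near W, `|Fs - F s - a * D s| <= e * `|D s|.
Proof.
split=> [[Q /cvgrPdist_le Qa FQ] e e0|H].
  near=> s.
  have -> : Fs - F s = Q s * D s by near: s.
  rewrite -mulrBl normrM ler_wpM2r ?normr_ge0// distrC.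
  by near: s; exact: Qa.
exists (fun s => if D s == 0 then a else (Fs - F s) / D s).
  apply/cvgrPdist_le => e e0; near=> s.
  case: eqVneq => [|Ds]; first by rewrite subrr normr0 ltW.
  have : `|Fs - F s - a * D s| <= e * `|D s| by near: s; exact: H.
  rewrite -ler_pdivrMr ?normr_gt0// -normfV -normrM mulrBl mulfK//.
  by rewrite distrC.
near=> s.
(* The tolerance 1 is arbitrary: where [D s = 0] the bound is 0 and forces [F s = Fs]. *)
have : `|Fs - F s - a * D s| <= 1 * `|D s| by near: s; exact: H.
case: eqVneq => [->|Ds _]; last by rewrite mulfVK.
by rewrite mulr0 subr0 normr0 mulr0 normr_le0 => /eqP.
Unshelve. all: by end_near. Qed.

Lemma slope_cvg_eq {C : numFieldType} {I : Type} {W : set_system I}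
    {FW : Filter W} (Fs Gs : C) (F G D : I -> C) (a : C) :
  Gs = Fs -> (\forall s \near W, G s = F s) ->
  slope_cvg W Fs F D a -> slope_cvg W Gs G D a.
Proof.
move=> -> GF [Q Qa FQ]; exists Q => //.
by near=> s; rewrite (near GF)//; near: s.
Unshelve. all: by end_near. Qed.

Lemma slope_cvg_cst {C : numFieldType} {I : Type} {W : set_system I}
    {FW : Filter W} (c : C) (D : I -> C) :
  slope_cvg W c (fun=> c) D 0.
Proof.
exists (fun=> 0); first exact: cvg_cst.
by near=> s; rewrite subrr mul0r.
Unshelve. all: by end_near. Qed.

Lemma slope_cvgM {C : numFieldType} {I : Type} {W : set_system I}
    {FW : Filter W} (Fs Gs Gt : C) (F G D : I -> C) (a b : C) :
  slope_cvg W Fs F D a -> slope_cvg W Gs G D b -> G @ W --> Gt ->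
  slope_cvg W (Fs * Gs) (fun s => F s * G s) D (a * Gt + Fs * b).
Proof.
move=> [P Pa FP] [Q Qb GQ] GGt.
(* From [Fs * Gs - F s * G s = (Fs - F s) * G s + Fs * (Gs - G s)]. *)
exists (fun s => P s * G s + Fs * Q s).
  by apply: cvgD; [exact: cvgM | apply: cvgM => //; exact: cvg_cst].
near=> s.
have -> : (P s * G s + Fs * Q s) * D s
    = P s * D s * G s + Fs * (Q s * D s) by rewrite mulrDl mulrAC mulrA.
rewrite -(near FP)// -(near GQ)//.
by rewrite mulrBl mulrBr [RHS]addrC addrA subrK.
Unshelve. all: by end_near. Qed.

Lemma slope_cvgV {C : numFieldType} {I : Type} {W : set_system I}
    {FW : Filter W} (Gs Gt : C) (G D : I -> C) (b : C) :
  Gs != 0 -> Gt != 0 ->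
  slope_cvg W Gs G D b -> G @ W --> Gt ->
  slope_cvg W Gs^-1 (fun s => (G s)^-1) D (- b / (Gs * Gt)).
Proof.
move=> Gs0 Gt0 [Q Qb GQ] GGt.
(* From [Gs^-1 - (G s)^-1 = - (Gs - G s) / (Gs * G s)], valid near the limit point since [Gt != 0]
   keeps [G s] nonzero. *)
exists (fun s => - Q s / (Gs * G s)).
  apply: cvgM; first exact: cvgN.
  by apply: cvgV; [rewrite mulf_neq0 | apply: cvgM => //; exact: cvg_cst].
have G0 : \forall s \near W, G s != 0 by exact: (cvgr_neq0 Gt GGt Gt0).
near=> s.
have Gs'0 : G s != 0 by near: s.
rewrite mulrAC mulNr -(near GQ)//.
by rewrite opprB mulrBl invfM mulrCA mulfV// mulr1 mulrA mulfV// mul1r.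
Unshelve. all: by end_near. Qed.

Lemma slope_cvg_div {C : numFieldType} {I : Type} {W : set_system I}
    {FW : Filter W} (Fs Gs Gt : C) (F G D : I -> C) (a b : C) :
  Gs != 0 -> Gt != 0 ->
  slope_cvg W Fs F D a -> slope_cvg W Gs G D b -> G @ W --> Gt ->
  slope_cvg W (Fs / Gs) (fun s => F s / G s) D
    ((a * Gs - Fs * b) / (Gs * Gt)).
Proof.
move=> Gs0 Gt0 FP GP GGt.
have -> : (a * Gs - Fs * b) / (Gs * Gt) = a * Gt^-1 + Fs * (- b / (Gs * Gt)).
  by field; rewrite Gs0 Gt0.
apply: slope_cvgM => //; first exact: slope_cvgV.
by apply: cvgV.
Qed.

(** * Transfer to structural derivatives *)

Lemma is_sderiveP {R : realType} (T : set R) (k : int) (l : R) (p f : R -> R)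
    (t : R) (a : R[i]) :
  is_sderive T k l p f t a <->
  @slope_cvg (complexField R) R (within T (nbhs t)) (cpow k l (f (sigma T t)))
    (fun s => cpow k l (f s)) (fun s => (p (sigma T t) - p s)%:C) a.
Proof.
split=> [H|/slope_cvgP H e e0].
  apply/slope_cvgP => e; rewrite ltcE /= => /andP[/eqP Ime e0].
  have -> : e = (complex.Re e)%:C by apply/eqP; rewrite eq_complex /= Ime !eqxx.
  have [d d0 Hd] := H _ e0.
  exists d => //= s; rewrite /ball_ /= distrC => sd Ts.
  by rewrite norm_real_complex -rmorphM; exact: Hd.
have /H[d /= d0 Hd] : 0 < (e%:C : complexField R) by rewrite ltcR.
exists d => // s Ts sd.
by rewrite rmorphM /= -norm_real_complex; apply: Hd; rewrite //= distrC.
Qed.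

(** The point [t] lies in each of its neighborhoods, so [s = t] is allowed for every tolerance;
    letting the tolerance shrink makes the error zero. *)
Lemma is_sderive_at {R : realType} {T : set R} {k : int} {l : R} {p f : R -> R}
    {t : R} {a : R[i]} : T t -> is_sderive T k l p f t a ->
  cpow k l (f (sigma T t)) - cpow k l (f t) = a * (p (sigma T t) - p t)%:C.
Proof.
move=> Tt H; apply/eqP; rewrite -subr_eq0 -normr_eq0.
set z := _ - _; set c := `|p (sigma T t) - p t|.
have z_le e : 0 < e -> `|z| <= (e * c)%:C.
  by move=> /H[d d0]; apply=> //; rewrite subrr normr0.
have c0 : 0 <= c by exact: normr_ge0.
move: z_le; rewrite normc_def; set r := Num.sqrt _ => z_le.
rewrite fmorph_eq0 eq_le sqrtr_ge0 andbT.
apply/ler_addgt0Pr => e e0; rewrite add0r.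
have c1 : 0 < c + 1 by rewrite ltr_wpDl.
(* Dividing by [c + 1] keeps the tolerance meaningful when [c = 0] and still gives a bound of at
   most [e]. *)
have : r <= e / (c + 1) * c by rewrite -lecR z_le// divr_gt0.
move=> /le_trans; apply.
by rewrite mulrAC ler_pdivrMr// ler_pM2l// lerDl.
Qed.

Lemma cvg_cpow_within {R : realType} {T : set R} {f : R -> R} {t : R} (k : int)
    {l : R} : T t -> {within T, continuous f} -> 0 < l ->
  (cpow k l (f s) : complexField R) @[s --> within T (nbhs t)]
    --> (cpow k l (f t) : complexField R).
Proof.
move=> Tt /subspace_continuousP/(_ t Tt) ft l0.
exact: (cvg_comp _ _ ft (cpow_continuous k l (f t) l0)).
Qed.

Theorem theorem13 (R : realType) (T : set R) (k : int) (l : R)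
  (p f g : R -> R) (t : R) (a b : R[i])
  (hT : time_scale T) (hl : 0 < l) (ht : kappa T t)
  (hfc : {within T, continuous f}) (hgc : {within T, continuous g})
  (hf : is_sderive T k l p f t a) (hg : is_sderive T k l p g t b) :
  [/\ (forall c : R,
         near_and_at_sigma T t (fun s => cpow_mul_rule k l c (f s)) ->
         is_sderive T k l p (fun s => c * f s) t (cpow k l c * a)),
      (a * cpow k l (g t) + cpow k l (f (sigma T t)) * b
         = a * cpow k l (g (sigma T t)) + cpow k l (f t) * b
       /\ (near_and_at_sigma T t (fun s => cpow_mul_rule k l (f s) (g s)) ->
           is_sderive T k l p (fun s => f s * g s) t
             (a * cpow k l (g t) + cpow k l (f (sigma T t)) * b))),
      (f t * f (sigma T t) <> 0 ->
         near_and_at_sigma T t (fun s => cpow_div_rule k l 1 (f s)) ->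
         is_sderive T k l p (fun s => 1 / f s) t
           (- a / (cpow k l (f (sigma T t)) * cpow k l (f t))))
    & (g t * g (sigma T t) <> 0 ->
         near_and_at_sigma T t (fun s => cpow_div_rule k l (f s) (g s)) ->
         is_sderive T k l p (fun s => f s / g s) t
           ((a * cpow k l (g t) - cpow k l (f t) * b)
              / (cpow k l (g (sigma T t)) * cpow k l (g t))))].
Proof.
have Tt : T t by case: ht.
have [fP gP] := (hf, hg); move: fP gP => /is_sderiveP fP /is_sderiveP gP.
have f_cvg := cvg_cpow_within k Tt hfc hl.
have g_cvg := cvg_cpow_within k Tt hgc hl.
have prod_eq : a * cpow k l (g t) + cpow k l (f (sigma T t)) * b
    = a * cpow k l (g (sigma T t)) + cpow k l (f t) * b.
  exact: product_rule_sym (is_sderive_at Tt hf) (is_sderive_at Tt hg).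
split.
- move=> c [cfs cf]; apply/is_sderiveP.
  (* The derivative is put in the product rule's shape, the constant factor having slope 0. *)
  rewrite -[X in slope_cvg _ _ _ _ X]add0r -[X in X + _](mul0r (cpow k l (f t))).
  apply: slope_cvg_eq (slope_cvgM _ _ _ _ _ _ _ _
    (slope_cvg_cst (cpow k l c) _) fP f_cvg).
    exact: cpowM.
  by near=> s; apply: cpowM => //; near: s.
- split=> //.
  move=> [fgs fg]; apply/is_sderiveP.
  apply: slope_cvg_eq (slope_cvgM _ _ _ _ _ _ _ _ fP gP g_cvg).
    exact: cpowM.
  by near=> s; apply: cpowM => //; near: s.
- move=> /eqP; rewrite mulf_eq0 negb_or => /andP[ft0 fs0] [fs f1].
  apply/is_sderiveP; rewrite -[- a]add0r -(mul0r (cpow k l (f (sigma T t)))).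
  (* the quotient rule with numerator 1 gives (0 * f^l(sigma t) - 1 * a) / ... *)
  rewrite -[in X in _ - X](mul1r a).
  apply: slope_cvg_eq (slope_cvg_div _ _ _ _ _ _ _ _ _ _
    (slope_cvg_cst 1 _) fP f_cvg).
  + by rewrite cpow_div// cpow1.
  + by near=> s; rewrite cpow_div ?cpow1//; near: s.
  + by rewrite cpow_eq0.
  + by rewrite cpow_eq0.
- move=> /eqP; rewrite mulf_eq0 negb_or => /andP[gt0 gs0] [fgs fg].
  (* The slope quotient rule yields a numerator evaluated at sigma(t); moving terms across [prod_eq]
     shows that it equals the one at [t]. *)
  have -> : a * cpow k l (g t) - cpow k l (f t) * b =
            a * cpow k l (g (sigma T t)) - cpow k l (f (sigma T t)) * b.
    by apply/eqP; rewrite subr_eq addrAC eq_sym subr_eq eq_sym; apply/eqP.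
  apply/is_sderiveP.
  apply: slope_cvg_eq (slope_cvg_div _ _ _ _ _ _ _ _ _ _ fP gP g_cvg).
  + exact: cpow_div.
  + by near=> s; apply: cpow_div => //; near: s.
  + by rewrite cpow_eq0.
  + by rewrite cpow_eq0.
Unshelve. all: by end_near. Qed.
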